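(* Let $n\ge 1$ be an integer, and suppose that $x_n=m$ is an integer, where $x_n=\tan\bigl(\sum_{k=1}^n\arctan k\bigr)$. Then the following hold. (1) $K_n\mid (1+m^2)$. (2) If $K_n>1$, then $|m|\ge\sqrt{K_n-1}$ and $$\log|m|\ \ge\ \Bigl(\tfrac12+o(1)\Bigr)\,n\log n .$$ Here $o(1)$ denotes a quantity depending only on $n$ that tends to $0$ as $n\to\infty$; that is, there is a function $\varepsilon:\mathbb{Z}_{\ge1}\to\mathbb{R}$ with $\varepsilon(n)\to0$ such that for every $n\ge1$ with $K_n>1$ and $x_n=m\in\mathbb{Z}$ one has $\log|m|\ge(\tfrac12+\varepsilon(n))\,n\log n$.
   Context: For integers $n\ge1$ define $x_n=\tan\bigl(\sum_{k=1}^{n}\arctan k\bigr)$. It is known that $\sum_{k=1}^n\arctan k$ is never an odd multiple of $\pi/2$, so $x_n$ is well defined; it is a rational number. Define $\omega_n=\prod_{k=1}^n(1+k^2)$. For a prime $p$, $\nu_p$ denotes the $p$-adic valuation. Define $K_n=\prod_{p}p$, where the product runs over all primes $p$ for which $\nu_p(\omega_n)$ is odd (an empty product equals $1$). *)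

(* Defs.v *)
From mathcomp Require Import all_boot all_order all_algebra.
From mathcomp Require Import all_classical all_reals all_analysis.

Set Implicit Arguments.
Unset Strict Implicit.
Unset Printing Implicit Defensive.

Import Order.TTheory GRing.Theory Num.Theory.
Import numFieldNormedType.Exports.

Local Open Scope ring_scope.

(* [tan] is [sin / cos], so it would be 0 at odd multiples of pi / 2; the sum
   of arctangents below never takes such a value. *)
Definition xseq (R : realType) (n : nat) : R :=
  tan (\sum_(1 <= k < n.+1) atan (k%:R : R)).

Definition omega (n : nat) : nat := (\prod_(1 <= k < n.+1) (1 + k ^ 2))%N.

(* A prime that does not divide [omega n] has valuation 0, which is even, so
   restricting the product to the prime divisors of [omega n] loses nothing. *)
Definition Kseq (n : nat) : nat :=
  (\prod_(p <- primes (omega n) | odd (logn p (omega n))) p)%N.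

(* Main.v *)
(* [\prod_(k <= n) (1 + i k) = A + i B] has norm [omega n] and [x_n = B / A], so [x_n = m]
   gives [omega n = A^2 (1 + m^2)]; this settles everything about [Kseq n].
   A prime [p > 2 n] divides [omega n] at most once, hence it does not divide [A], and
   [1 + m^2] is at least the part of [omega n] made of such primes.  For [p <= 2 n],
   counting the square roots of [-1] modulo powers of [p] gives
   [logn p (omega n) <= (1 + chi p) (n / (p - 1) + O(log n / log p))], with [chi] the
   nonprincipal character modulo 4.  By Mertens' estimate for [\sum_p ln p / p] and its
   analogue [\sum_p chi p ln p / p = O(1)], a consequence of [L(1, chi) > 0], these
   primes contribute at most [n ln n + O(n)] to [ln (omega n) >= 2 n ln n - O(n)]. *)

Require Import Defs.
From mathcomp Require Import all_boot all_order all_algebra.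
From mathcomp Require Import all_classical all_reals all_analysis.
From mathcomp Require Import zify ring lra.

Import Order.TTheory GRing.Theory Num.Theory.
Import numFieldNormedType.Exports.

(** * Divisibility by primes and the size of primorials *)

Lemma dvdn_prod_primes (s : seq nat) (m : nat) :
  uniq s -> {in s, forall p, prime p && (p %| m)%N} -> (\prod_(p <- s) p %| m)%N.
Proof.
elim: s => [|p s IH] /=; first by rewrite big_nil.
move=> /andP[pNs us] H; rewrite big_cons.
have /andP[pp pm] := H p (mem_head p s).
rewrite Gauss_dvd ?pm ?IH//; first by move=> q qs; apply: H; rewrite in_cons qs orbT.
rewrite big_seq; elim/big_ind: _ => [|x y cx cy|q qs].
- by rewrite coprimen1.
- by rewrite coprimeMr cx.
- have /andP[pq _] : prime q && (q %| m) by apply: H; rewrite in_cons qs orbT.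
  rewrite prime_coprime// dvdn_prime2//; apply: contraNneq pNs => -> //.
Qed.

Lemma bin_le_exp2 (n k : nat) : ('C(n, k) <= 2 ^ n)%N.
Proof.
elim: n k => [|n IH] [|k] //=; first by rewrite bin0 expn_gt0.
by rewrite binS expnS mul2n -addnn leq_add.
Qed.

(** [p] divides [n!] but neither [k!] nor [(n - k)!], whose factors are all smaller than [p]. *)
Lemma prime_dvd_bin (p n k : nat) :
  prime p -> (k < p)%N -> (n - k < p)%N -> (p <= n)%N -> (p %| 'C(n, k))%N.
Proof.
move=> pp kp nkp pn; have E := @bin_fact n k ltac:(lia).
have : (p %| n`!)%N by apply: dvdn_fact; rewrite pn prime_gt0.
rewrite -E !Euclid_dvdM//.
have notfact j : (j < p)%N -> (p %| j`!)%N = false.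
  elim: j => [|j IH] jp; first by rewrite dvdn1; case: p pp {kp nkp pn E jp} => [|[]].
  rewrite factS Euclid_dvdM// IH ?orbF; last by lia.
  by apply: negbTE; apply/negP => /dvdn_leq; lia.
by rewrite !notfact// !orbF.
Qed.

(** Strong induction by halving: with [h] half of [n] rounded up, every prime in [(h, n]] divides
    ['C(n, h)], which is at most [2 ^ n]. The constant 4 absorbs the rounding, since
    [4 h + n <= 4 n] as soon as [n >= 2]. *)
Lemma primorial_le (n : nat) :
  (\prod_(1 <= p < n.+1 | prime p) p <= 2 ^ (4 * n))%N.
Proof.
elim/ltn_ind: n => n IH.
have [n2|n2] := ltnP n 2.
  case: n n2 {IH} => [|[]] // _; first by rewrite big_geq.
  by rewrite big_mkcond /= big_nat1.
pose h := uphalf n.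
have hn : (h < n)%N by rewrite /h uphalf_half; lia.
rewrite (@big_cat_nat _ _ _ h.+1) //=; last by lia.
apply: (@leq_trans (2 ^ (4 * h) * 2 ^ n)); last first.
  by rewrite -expnD leq_exp2l// /h uphalf_half; lia.
apply: leq_mul; first exact: IH.
apply: leq_trans (bin_le_exp2 n h); apply: dvdn_leq.
  by rewrite bin_gt0 ltnW.
rewrite -big_filter; apply: dvdn_prod_primes => [|p].
  by rewrite filter_uniq// iota_uniq.
rewrite mem_filter mem_index_iota => /andP[pp /andP[hp pn]].
rewrite pp /=; apply: prime_dvd_bin => //.
move: hp; rewrite /h uphalf_half; lia.
Qed.

(** * Valuations of [omega n] and its part at large primes *)

Lemma omega_gt0 (n : nat) : (0 < omega n)%N.
Proof. by rewrite /omega; elim/big_ind: _ => // x y; rewrite muln_gt0 => -> ->. Qed.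

Lemma omegaS (n : nat) : omega n.+1 = (omega n * (1 + n.+1 ^ 2))%N.
Proof. by rewrite /omega big_nat_recr. Qed.

Lemma logn_omega (p n : nat) :
  logn p (omega n) = (\sum_(1 <= k < n.+1) logn p (1 + k ^ 2))%N.
Proof.
elim: n => [|n IH]; first by rewrite /omega !big_geq// logn1.
by rewrite omegaS lognM ?omega_gt0// IH [RHS]big_nat_recr.
Qed.

(** The square of [p] exceeds every factor [1 + k ^ 2], and if [p] divided two of them, for [k < l],
    it would divide [(l - k) * (l + k)], whose factors are positive and less than [p]. *)
Lemma logn_omega_large (p n : nat) :
  prime p -> (2 * n < p)%N -> (logn p (omega n) <= 1)%N.
Proof.
move=> pp; elim: n => [|n IH] np; first by rewrite /omega big_geq// logn1.
rewrite omegaS lognM ?omega_gt0//.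
have l2 : (logn p (1 + n.+1 ^ 2) <= 1)%N.
  rewrite leqNgt -pfactor_dvdn//; apply/negP => /dvdn_leq; nia.
have [pd|pd] := boolP (p %| 1 + n.+1 ^ 2)%N; last first.
  by rewrite (@lognE p (_ + _)) (negbTE pd) pp addn_gt0 /= addn0 IH//; lia.
suff -> : logn p (omega n) = 0%N by [].
rewrite logn_omega big_nat big1// => k /andP[k1 kn].
rewrite lognE pp addn_gt0 /=; case: ifP => // pk.
have : (p %| (n.+1 - k) * (n.+1 + k))%N.
  have -> : ((n.+1 - k) * (n.+1 + k) = (1 + n.+1 ^ 2) - (1 + k ^ 2))%N by nia.
  exact: dvdn_sub.
by rewrite Euclid_dvdM// => /orP[] /dvdn_leq; lia.
Qed.

(** A square does not change the parity of a valuation, so each prime of odd valuation in [omega n]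
    has odd, hence nonzero, valuation in [b]. *)
Lemma Kseq_dvd (n a b : nat) : omega n = (a ^ 2 * b)%N -> (Kseq n %| b)%N.
Proof.
move=> E; have := omega_gt0 n; rewrite E muln_gt0 => /andP[a0 b0].
rewrite /Kseq -big_filter; apply: dvdn_prod_primes => [|p].
  by rewrite filter_uniq// primes_uniq.
rewrite mem_filter E mem_primes lognM// lognX => /andP[lo /and3P[pp _ _]].
rewrite pp /= -[p]expn1 pfactor_dvdn// lt0n.
by apply: contraTneq lo => ->; rewrite addn0 mul2n odd_double.
Qed.

(** A prime above [2 n] divides [omega n] at most once, so it cannot divide [a]; the part of
    [omega n] at such primes therefore comes from [b] alone. *)
Lemma omega_le_small_part (n a b : nat) : omega n = (a ^ 2 * b)%N ->
  (omega n <= (\prod_(1 <= p < (2 * n).+1 | prime p) p ^ logn p (omega n)) * b)%N.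
Proof.
move=> E; have := omega_gt0 n; rewrite {1}E muln_gt0 => /andP[a0 b0].
pose pi : nat_pred := [pred p : nat | (p <= 2 * n)%N].
rewrite -{1}(@partnC pi (omega n)) ?omega_gt0//; apply: leq_mul.
  rewrite (@widen_partn (2 * n + omega n)) ?leq_addl// big_mkcond.
  rewrite (@big_cat_nat _ _ _ (2 * n).+1) //=; last by rewrite ltnS leq_addr.
  rewrite [X in (_ * X)%N]big_nat [X in (_ * X)%N]big1 ?muln1; last first.
    by move=> i /andP[ni _]; rewrite inE leqNgt ni.
  rewrite big_ltn//.
  (* The product of parts starts at index 0, where the factor is [0 ^ 0 = 1]. *)
  have -> : (if 0%N \in pi then 0 ^ logn 0 (omega n) else 1)%N = 1%N.
    by rewrite lognE.
  rewrite mul1n [X in (_ <= X)%N]big_mkcond; apply: leq_prod => i _.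
  case: (boolP (prime i)) => ip; last by rewrite lognE (negbTE ip) if_same.
  by case: ifP => // _; rewrite expn_gt0 prime_gt0.
rewrite E partnM// [(a ^ 2)`__]part_p'nat ?mul1n; last first.
  rewrite pnatNK; apply/pnatP => [//|p pp pa].
  rewrite inE leqNgt; apply/negP => /(@logn_omega_large p n pp).
  rewrite E lognM// lognX.
  have a1 : (0 < a)%N by move: a0; rewrite expn_gt0 orbF.
  have : (0 < logn p a)%N by move: pa; rewrite Euclid_dvdX// andbT logn_gt0 mem_primes pp a1.
  lia.
by apply: dvdn_leq => //; apply: dvdn_part.
Qed.

(** * Square roots of -1 modulo prime powers *)

(** Within one residue class, [k] is determined by the quotient [k %/ q], which takes at most
    [n %/ q + 1] values. *)
Lemma count_congruent (P : pred nat) (q n : nat) : (0 < q)%N ->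
  (forall x y, P x -> P y -> x = y %[mod q]) ->
  (\sum_(1 <= k < n.+1) P k <= n %/ q + 1)%N.
Proof.
move=> q0 H; rewrite -big_mkcond /= sum1_count -size_filter.
set s := seq.filter _ _.
have inj : {in s &, injective (fun k => k %/ q)}.
  move=> x y; rewrite !mem_filter => /andP[Px _] /andP[Py _] e.
  by rewrite (divn_eq x q) (divn_eq y q) e (H x y).
rewrite -(size_map (fun k => k %/ q)) addn1 -(size_iota 0 (n %/ q).+1).
apply: uniq_leq_size => [|_ /mapP[k ks ->]].
  by rewrite map_inj_in_uniq // filter_uniq // iota_uniq.
move: ks; rewrite mem_filter mem_index_iota mem_iota => /andP[_ /andP[_ kn]].
by rewrite add0n ltnS leq_div2r.
Qed.

(** Induction on [h] in steps of two, through [x ^ (h + 2) + 1 + (x ^ 2 - 1) = x ^ 2 * (x ^ h +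
    1)]. *)
Lemma dvdn_odd_exp_add1 (x h : nat) : odd h -> (x + 1 %| x ^ h + 1)%N.
Proof.
move=> oh; rewrite -(odd_double_half h) oh add1n.
elim: h./2 => [|t IH]; first by rewrite expn1.
have d2 : (x + 1 %| x ^ 2 - 1)%N.
  have -> : (x ^ 2 - 1 = (x - 1) * (x + 1))%N by nia.
  exact: dvdn_mull.
rewrite -(dvdn_addl _ d2); have [->|x0] := posnP x; first by rewrite dvd1n.
have -> : (x ^ (t.+1).*2.+1 + 1 + (x ^ 2 - 1) = x ^ 2 * (x ^ t.*2.+1 + 1))%N.
  rewrite doubleS -[(t.*2.+2).+1]add2n expnD; have : (0 < x ^ 2)%N by rewrite expn_gt0 x0.
  nia.
exact: dvdn_mull.
Qed.

Lemma ndvdn_sqr_add1 (p k : nat) : prime p -> (p %| 1 + k ^ 2)%N -> ~~ (p %| k)%N.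
Proof.
move=> pp pk; apply/negP => pdk; move: pk; rewrite dvdn_addl.
  by rewrite dvdn1 => /eqP p1; rewrite p1 in pp.
by rewrite Euclid_dvdX// pdk.
Qed.

(** Here [p./2] is [(p - 1) / 2]. If it were odd, [k ^ 2 + 1] would divide [k ^ (p - 1) + 1], so [p]
    would divide [k ^ p + k], which is [2 k] modulo [p] by Fermat. *)
Lemma prime_dvd_sqr_add1 (p k : nat) :
  prime p -> odd p -> (p %| 1 + k ^ 2)%N -> odd p./2 = false.
Proof.
move=> pp op pk; apply/negbTE/negP => oh.
have pk' : (p %| k ^ p + k)%N.
  have -> : (k ^ p + k = k * ((k ^ 2) ^ p./2 + 1))%N.
    have {1}-> : p = (1 + 2 * p./2)%N by move: op (odd_double_half p) => ->; lia.
    by rewrite mulnDr muln1 -expnM -expnS.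
  apply: dvdn_mull; apply: dvdn_trans (dvdn_odd_exp_add1 (k ^ 2) _ oh).
  by rewrite addnC.
have : (p %| 2 * k)%N.
  rewrite mul2n -addnn /dvdn -modnDml -(fermat_little k pp) modnDml.
  exact: pk'.
rewrite Euclid_dvdM// => /orP[|pdk].
  move=> /dvdn_leq => /(_ isT); move: op (prime_gt1 pp); lia.
by have := @ndvdn_sqr_add1 p k pp pk; rewrite pdk.
Qed.

(* The number [1 + chi p] of square roots of [-1] modulo the prime [p]. *)
Definition nroots (p : nat) : nat :=
  if odd p then (if odd p./2 then 0 else 2)%N else 1%N.

(** For odd [p] and a fixed root [k0], any root [k] makes [p ^ j] divide [(k - k0) * (k + k0)]. As
    [p] does not divide [2 k0], the whole of [p ^ j] divides one factor, so the roots lie in the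
    classes of [k0] and [- k0]. *)
Lemma count_roots (p j n : nat) : prime p -> (0 < j)%N ->
  (\sum_(1 <= k < n.+1) (p ^ j %| 1 + k ^ 2) <= nroots p * (n %/ p ^ j + 1))%N.
Proof.
move=> pp j0; have q0 : (0 < p ^ j)%N by rewrite expn_gt0 prime_gt0.
have pq : (p %| p ^ j)%N by rewrite -{1}[p]expn1 dvdn_exp2l.
rewrite /nroots; case: ifPn => [op|ep]; last first.
  (* The roots modulo 2 are the odd numbers, a single class; [1 + k ^ 2] is never divisible by 4, so
     [j >= 2] gives no root. *)
  have {ep} p2 : p = 2%N by case: (even_prime pp) => // op; rewrite op in ep.
  subst p; rewrite mul1n; apply: count_congruent => // x y.
  have [->|j1] := eqVneq j 1%N.
    by rewrite expn1 !dvdn2 !modn2 !oddD !oddX /=; case: (odd x); case: (odd y).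
  move=> /(dvdn_trans (@dvdn_exp2l 2 2 j ltac:(lia))) Hx _; exfalso.
  move: Hx; have := odd_double_half x; case: (odd x) => /= <- /dvdnP[z]; nia.
case: (boolP [exists k : 'I_n.+1, p ^ j %| 1 + k ^ 2]) => [/existsP[[k0 /= _] Hk0]|/existsPn no]; last first.
  rewrite big_nat big1 ?leq0n// => i /andP[_ ni].
  by have /negbTE -> := no (Ordinal ni).
have -> : odd p./2 = false by apply: (@prime_dvd_sqr_add1 p k0) => //; apply: dvdn_trans Hk0.
have pNk0 : ~~ (p %| k0)%N by apply: ndvdn_sqr_add1 => //; apply: dvdn_trans Hk0.
apply: (@leq_trans (\sum_(1 <= k < n.+1) (k == k0 %[mod p ^ j])
                  + \sum_(1 <= k < n.+1) (p ^ j %| k + k0))%N).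
  rewrite -big_split /=; apply: leq_sum => k _.
  case: (boolP (p ^ j %| 1 + k ^ 2)%N) => // Hk.
  suff : (k == k0 %[mod p ^ j]) || (p ^ j %| k + k0)%N by case: eqP; case: dvdn.
  (* The claim is symmetric in [k] and [k0]; the order makes the truncated subtraction exact. *)
  wlog le : k k0 Hk Hk0 pNk0 / (k0 <= k)%N => [W|].
    have [|kk] := leqP k0 k; first exact: W.
    rewrite eq_sym addnC; apply: W => //; last exact: ltnW.
    by apply: ndvdn_sqr_add1 => //; apply: dvdn_trans Hk.
  have Hd : (p ^ j %| (k - k0) * (k + k0))%N.
    have -> : ((k - k0) * (k + k0) = (1 + k ^ 2) - (1 + k0 ^ 2))%N by move: le; clear; nia.
    exact: dvdn_sub.
  rewrite eqn_mod_dvd//.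
  have [pd|pd] := boolP (p %| k - k0)%N; last first.
    by rewrite Gauss_dvdr in Hd; rewrite ?Hd ?orbT// coprimeXl// prime_coprime.
  rewrite Gauss_dvdl in Hd; first by rewrite Hd.
  rewrite coprimeXl// prime_coprime//; apply/negP => pd2.
  have : (p %| 2 * k0)%N.
    have -> : (2 * k0 = (k + k0) - (k - k0))%N by move: le; clear; lia.
    exact: dvdn_sub.
  rewrite Euclid_dvdM// (negbTE pNk0) orbF => /dvdn_leq => /(_ isT).
  by move: op (prime_gt1 pp); clear; lia.
rewrite mul2n -addnn; apply: leq_add; apply: count_congruent => //.
  by move=> x y /eqP -> /eqP ->.
move=> x y Hx Hy; wlog le : x y Hx Hy / (y <= x)%N => [W|].
  by have [|/ltnW] := leqP y x; [exact: W|move=> ?; apply/esym/W].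
apply/eqP; rewrite eqn_mod_dvd//.
have -> : (x - y = (x + k0) - (y + k0))%N by rewrite subnDr.
exact: dvdn_sub.
Qed.

(** Each valuation is the number of [j >= 1] with [p ^ j] dividing [1 + k ^ 2], and no such [j]
    exceeds the truncated logarithm of [1 + n ^ 2]; exchanging the sums leaves counts of roots. *)
Lemma logn_omega_le (p n : nat) : prime p ->
  (logn p (omega n) <=
   nroots p * \sum_(1 <= j < (trunc_log p (1 + n ^ 2)).+1) (n %/ p ^ j + 1))%N.
Proof.
move=> pp; set J := trunc_log _ _.
have lognJ k : (k <= n)%N ->
    logn p (1 + k ^ 2) = (\sum_(1 <= j < J.+1) (p ^ j %| 1 + k ^ 2))%N.
  move=> kn; set l := logn _ _.
  have lJ : (l <= J)%N.
    apply: trunc_log_max; first exact: prime_gt1.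
    apply: (@leq_trans (1 + k ^ 2)); last by nia.
    by apply: dvdn_leq => //; rewrite pfactor_dvdn.
  under eq_bigr do rewrite pfactor_dvdn//.
  rewrite (@big_cat_nat _ _ _ l.+1)//= big_nat.
  under eq_bigr => i /andP[_ il] do rewrite -/l -ltnS il.
  rewrite -big_nat sum_nat_const_nat subn1 muln1 big_nat big1 ?addn0// => i /andP[li _].
  by rewrite -/l leqNgt li.
rewrite logn_omega big_nat.
under eq_bigr => k /andP[_ kn] do rewrite lognJ//.
rewrite -big_nat exchange_big /= big_distrr /= big_nat [X in (_ <= X)%N]big_nat.
by apply: leq_sum => j /andP[j1 _]; apply: count_roots.
Qed.

(** * Logarithms, Chebyshev's bound and Mertens' upper estimate *)

Local Open Scope classical_set_scope.
Local Open Scope ring_scope.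

Lemma ln_prod (R : realType) (I : Type) (s : seq I) (P : pred I) (F : I -> R) :
  (forall i, P i -> 0 < F i) ->
  ln (\prod_(i <- s | P i) F i) = \sum_(i <- s | P i) ln (F i).
Proof.
move=> F0; suff [] : 0 < \prod_(i <- s | P i) F i /\
  ln (\prod_(i <- s | P i) F i) = \sum_(i <- s | P i) ln (F i) by [].
apply: (big_rec2 (fun x y => 0 < x /\ ln x = y)) => [|i x y Pi [y0 <-]].
  by rewrite ln1.
by rewrite mulr_gt0 ?F0// lnM ?posrE ?F0.
Qed.

Lemma ln_nat_ge0 (R : realType) (n : nat) : 0 <= ln n%:R :> R.
Proof.
case: n => [|n]; first by rewrite ln0.
by rewrite ln_ge0// ler1n.
Qed.

Lemma ler_ln_nat (R : realType) (m n : nat) :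
  (0 < m)%N -> (m <= n)%N -> ln m%:R <= ln n%:R :> R.
Proof. by move=> m0 mn; rewrite ler_ln ?posrE ?ltr0n ?ler_nat//; apply: leq_trans mn. Qed.

Lemma ln_half_le (R : realType) : 1 / 2 <= ln 2 :> R.
Proof.
have := @le_ln1Dx R (- (1 / 2)) ltac:(lra).
have -> : 1 + - (1 / 2) = 2^-1 :> R by lra.
by rewrite lnV ?posrE//; lra.
Qed.

Lemma ln2_le1 (R : realType) : ln 2 <= 1 :> R.
Proof. have := @le_ln1Dx R 1 ltac:(lra); by have -> : 1 + 1 = 2 :> R by lra. Qed.

Lemma ln_add1_sub_le (R : realType) (x : R) : 0 < x -> ln (x + 1) - ln x <= x^-1.
Proof.
move=> x0; rewrite -ln_div ?posrE ?addr_gt0//.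
have -> : (x + 1) / x = 1 + x^-1 by field; rewrite gt_eqF.
by apply: le_ln1Dx; rewrite (@lt_trans _ _ 0) ?invr_gt0// ltrN10.
Qed.

Definition theta (R : realType) (n : nat) : R :=
  \sum_(1 <= p < n.+1 | prime p) ln p%:R.

Lemma theta_le (R : realType) (n : nat) : theta R n <= 4 * n%:R.
Proof.
rewrite /theta -ln_prod; last by move=> i /prime_gt0; rewrite ltr0n.
rewrite -natr_prod; apply: (@le_trans _ _ (ln (2 ^ (4 * n))%:R)).
  by apply: ler_ln_nat; [apply: prodn_cond_gt0 => i /prime_gt0|exact: primorial_le].
rewrite natrX lnXn// -[ln _ *+ _]mulr_natr natrM.
have := @ln2_le1 R; have : (0 : R) <= n%:R by []. nra.
Qed.

Lemma prod_pfactor (k n : nat) : (0 < k)%N -> (k <= n)%N ->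
  (\prod_(1 <= p < n.+1 | prime p) p ^ logn p k)%N = k.
Proof.
move=> k0 kn; rewrite -[RHS](@part_pnat_id predT); last by apply/pnatP.
rewrite (@widen_partn n)// [RHS]big_ltn//= {1}lognE /= mul1n big_mkcond /=.
by apply: eq_bigr => p _; case: ifPn => // /negbTE pp; rewrite lognE pp.
Qed.

Lemma ln_pfactor (R : realType) (k n : nat) : (0 < k)%N -> (k <= n)%N ->
  ln k%:R = \sum_(1 <= p < n.+1 | prime p) (logn p k)%:R * ln p%:R :> R.
Proof.
move=> k0 kn; rewrite -{1}(@prod_pfactor k n)// natr_prod ln_prod; last first.
  by move=> p pp; rewrite ltr0n expn_gt0 prime_gt0.
apply: eq_bigr => p pp; rewrite natrX lnXn ?ltr0n ?prime_gt0//.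
by rewrite mulr_natl.
Qed.

Lemma sum_mul_dvd (V : nmodType) (p n : nat) (F : nat -> V) : (0 < p)%N ->
  \sum_(1 <= k < n.+1 | (p %| k)%N) F k = \sum_(1 <= q < (n %/ p).+1) F (p * q)%N.
Proof.
move=> p0; elim: n => [|n IH]; first by rewrite div0n !big_geq.
rewrite big_mkcond big_nat_recr//= -big_mkcond IH divnS//.
case: ifP => [pn|_]; last by rewrite addr0.
rewrite add1n [RHS]big_nat_recr//=; congr (_ + F _).
by rewrite -[LHS](divnK pn) mulnC divnS// pn.
Qed.

(** Each multiple of [p] is counted once; higher powers of [p] are discarded. *)
Lemma sum_logn_ge (R : realType) (p n : nat) : prime p ->
  n%:R / p%:R - 1 <= \sum_(1 <= k < n.+1) (logn p k)%:R :> R.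
Proof.
move=> pp; have p0 := prime_gt0 pp.
apply: (@le_trans _ _ (\sum_(1 <= k < n.+1 | (p %| k)%N) 1)); last first.
  rewrite big_mkcond /= big_nat [leRHS]big_nat; apply: ler_sum => k /andP[k0 _].
  case: ifP => // pk; rewrite ler1n; by rewrite logn_gt0 mem_primes pp k0.
rewrite sum_mul_dvd// big_const_nat subn1 /= iter_addr addr0.
rewrite lerBlDr natr1 ler_pdivrMr ?ltr0n// -natrM ler_nat.
by rewrite ltnW// ltn_ceil.
Qed.

(** [ln n!] is at most [n ln n], and its prime factorization bounds it below by [n] times the sum
    minus [theta n]; the 4 is the constant of [theta_le]. *)
Lemma mertens_le (R : realType) (n : nat) : (0 < n)%N ->
  \sum_(1 <= p < n.+1 | prime p) ln p%:R / p%:R <= ln n%:R + 4 :> R.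
Proof.
move=> n0; have n0' : (0 : R) < n%:R by rewrite ltr0n.
have E : \sum_(1 <= k < n.+1) ln k%:R =
    \sum_(1 <= p < n.+1 | prime p) ln p%:R * \sum_(1 <= k < n.+1) (logn p k)%:R :> R.
  under [RHS]eq_bigr do rewrite big_distrr /=.
  rewrite [RHS]exchange_big /= big_nat [RHS]big_nat; apply: eq_bigr => k /andP[k1 kn].
  by rewrite (@ln_pfactor R k n)//; apply: eq_bigr => p _; rewrite mulrC.
have L : \sum_(1 <= k < n.+1) ln k%:R <= n%:R * ln n%:R :> R.
  have -> : n%:R * ln n%:R = \sum_(1 <= k < n.+1) ln n%:R :> R.
    by rewrite big_const_nat subn1 /= iter_addr addr0 mulr_natl.
  rewrite big_nat [leRHS]big_nat; apply: ler_sum => k /andP[k1 kn].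
  exact: ler_ln_nat.
have G : n%:R * (\sum_(1 <= p < n.+1 | prime p) ln p%:R / p%:R) - theta R n
    <= \sum_(1 <= k < n.+1) ln k%:R.
  rewrite E /theta big_distrr /= -sumrB; apply: ler_sum => p pp.
  have := @sum_logn_ge R p n pp; have := @ln_nat_ge0 R p.
  set x := ln _; set s := \sum_(_ <= _ < _) _ => x0 H.
  have -> : n%:R * (x / p%:R) - x = x * (n%:R / p%:R - 1) by ring.
  exact: ler_wpM2l.
rewrite -(ler_pM2l n0'); have := theta_le R n; lra.
Qed.

Lemma sum_ln_div_sqr_le (R : realType) (n : nat) :
  \sum_(2 <= k < n) ln k%:R / (k%:R * (k%:R - 1)) <= 2 :> R.
Proof.
have [n2|n2] := leqP n 2; first by rewrite big_geq.
(* A telescoping majorant: with [x = k - 1], the inequality [f k.+1 - f k >= ln k / (k (k - 1))]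
   amounts to [(x + 1) (ln (x + 1) - ln x) <= 2]. The bound 2 is [- f 2]. *)
pose f k : R := - ((ln k.-1%:R + 2) / k.-1%:R).
apply: (@le_trans _ _ (\sum_(2 <= k < n) (f k.+1 - f k))); last first.
  rewrite telescope_sumr ?(ltnW n2)// /f /= ln1 add0r divr1.
  have : 0 <= (ln n.-1%:R + 2) / n.-1%:R :> R.
    by rewrite divr_ge0// addr_ge0// ln_nat_ge0.
  lra.
rewrite big_nat [leRHS]big_nat; apply: ler_sum => -[|[|k]] // _.
rewrite /f /= -[k.+2%:R]natr1; have : (0 : R) < k.+1%:R by rewrite ltr0n.
set x : R := k.+1%:R => x0; rewrite addrK.
have H := @ln_add1_sub_le R x x0.
have x1 : 1 <= x by rewrite /x ler1n.
have H2 : (x + 1) * (ln (x + 1) - ln x) <= 2.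
  apply: (@le_trans _ _ ((x + 1) * x^-1)); first by rewrite ler_pM2l// addr_gt0.
  by rewrite ler_pdivrMr//; lra.
rewrite -subr_ge0.
have -> : - ((ln (x + 1) + 2) / (x + 1)) - - ((ln x + 2) / x) - ln (x + 1) / ((x + 1) * x)
  = (2 - (x + 1) * (ln (x + 1) - ln x)) / ((x + 1) * x) by field; rewrite !gt_eqF// addr_gt0.
by apply: divr_ge0; [lra|rewrite mulr_ge0//; lra].
Qed.
Lemma sum_prime_ln_div_sqr_le (R : realType) (n : nat) :
  \sum_(1 <= p < n.+1 | prime p) ln p%:R / (p%:R * (p%:R - 1)) <= 2 :> R.
Proof.
case: n => [|n]; first by rewrite big_geq.
apply: le_trans (sum_ln_div_sqr_le R n.+2); rewrite big_mkcond big_ltn//= add0r.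
rewrite big_nat [leRHS]big_nat; apply: ler_sum => k /andP[k2 _]; case: ifP => // _.
by rewrite divr_ge0 ?ln_nat_ge0// mulr_ge0// subr_ge0 ler1n ltnW.
Qed.

(** * The character modulo 4 and its analogue of Mertens' estimate *)

(* The nonprincipal Dirichlet character modulo 4. *)
Definition chi (R : pzRingType) (k : nat) : R := if odd k then (-1) ^+ k./2 else 0.
Arguments chi {R} k.

(** For [p = 2 a + 1] and [q = 2 b + 1], the half of [p q] is [2 a b + a + b], of the same parity as
    [a + b]. *)
Lemma chiM (R : pzRingType) (p q : nat) : chi (p * q) = chi p * chi q :> R.
Proof.
rewrite /chi oddM; have [op|] /= := boolP (odd p); last by rewrite mul0r.
have [oq|] := boolP (odd q); last by rewrite mulr0.
rewrite -exprD -signr_odd -[RHS]signr_odd; congr (_ ^+ _).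
have -> : (p * q)./2 = ((p./2 * q./2).*2 + (p./2 + q./2))%N.
  have := odd_double_half p; have := odd_double_half q.
  rewrite op oq => <- <-; rewrite (_ : ((_ + _) * _)%N =
    (true + ((p./2 * q./2).*2 + (p./2 + q./2)).*2)%N) ?half_bit_double; first by lia.
  lia.
by rewrite oddD odd_double.
Qed.

Lemma normr_chi_le1 (R : realDomainType) (k : nat) : `|chi k : R| <= 1.
Proof. by rewrite /chi; case: ifP; rewrite ?normr0// normrX normrN1 expr1n. Qed.

(** Leibniz's criterion; [(-1) ^+ m./2] is the value of [chi] at the first odd index from [m] on. *)
Lemma alternating_sum_bounds (R : realDomainType) (f : nat -> R) (m n : nat) :
  (forall k, (m <= k)%N -> 0 <= f k) ->
  (forall k, (m <= k)%N -> f k.+1 <= f k) ->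
  0 <= (-1) ^+ m./2 * \sum_(m <= k < n) chi k * f k <= f m.
Proof.
have [nm|/ltnW mn] := leqP n m; first by move=> f0 _; rewrite big_geq// mulr0 lexx f0.
move/subnKC: mn => <-; move: (n - m)%N => d; elim: d m => [|d IH] m f0 fS.
  by rewrite addn0 big_geq// mulr0 lexx f0.
rewrite big_ltn ?addnS ?ltnS ?leq_addr// -addSn.
have /andP[] := IH m.+1 (fun k H => f0 k (ltnW H)) (fun k H => fS k (ltnW H)).
have := fS m (leqnn m); have := f0 m (leqnn m).
set D := \sum_(_ <= _ < _) _ => fm0 fm1.
rewrite /chi /= uphalf_half; case: (odd m) => /=; last by rewrite mul0r !add0r => -> /le_trans ->.
rewrite exprS mulN1r mulNr mulrDr mulrA -expr2 sqrr_sign mul1r.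
lra.
Qed.

(** The partial sums of [L(1, chi)]. *)
Definition Lsum (R : realType) (n : nat) : R := \sum_(1 <= k < n.+1) chi k * k%:R^-1.

Lemma Lsum_tail (R : realType) (m n : nat) : (0 < m)%N ->
  0 <= (-1) ^+ m./2 * (\sum_(m <= k < n) chi k * k%:R^-1 : R) <= m%:R^-1.
Proof.
move=> m0; apply: (@alternating_sum_bounds R (fun k => k%:R^-1)) => // k mk.
by rewrite lef_pV2 ?posrE ?ltr0n ?ler_nat//; apply: leq_trans mk.
Qed.

Lemma Lsum_bounds (R : realType) (n : nat) : 0 <= Lsum R n <= 1.
Proof. by have := @Lsum_tail R 1 n.+1 isT; rewrite expr0 mul1r invr1. Qed.

(** The quantitative form of [L(1, chi) > 0]: the first term is 1 and the tail from 2 is at least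
    [- 1 / 2]. *)
Lemma Lsum_ge_half (R : realType) (n : nat) : (0 < n)%N -> 1 / 2 <= Lsum R n.
Proof.
move=> n0; rewrite /Lsum big_ltn// /chi /= expr0 mul1r invr1 -/chi.
have := @Lsum_tail R 2 n.+1 isT; rewrite /= expr1 /chi; lra.
Qed.

Lemma Lsum_dist (R : realType) (m n : nat) : (m <= n)%N ->
  `|Lsum R n - Lsum R m| <= m.+1%:R^-1.
Proof.
move=> mn; rewrite /Lsum (@big_cat_nat _ _ _ m.+1)//= addrAC subrr add0r.
have := @Lsum_tail R m.+1 n.+1 isT; set D := \sum_(_ <= _ < _) _ => /andP[D0 D1].
suff -> : `|D| = (-1) ^+ m.+1./2 * D by [].
by rewrite -(ger0_norm D0) normrM normrX normrN1 expr1n mul1r.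
Qed.
(** The coefficient of [ln p] when each [ln k] in the sum of [chi k * ln k / k] is expanded over the
    primes. *)
Definition Lsum_logn (R : realType) (p n : nat) : R :=
  \sum_(1 <= k < n.+1) chi k * k%:R^-1 * (logn p k)%:R.

(** Only multiples [k = p q] contribute, with valuation one more than that of [q]. *)
Lemma Lsum_logn_rec (R : realType) (p n : nat) : prime p ->
  Lsum_logn R p n = chi p / p%:R * (Lsum R (n %/ p) + Lsum_logn R p (n %/ p)).
Proof.
move=> pp; have p0 := prime_gt0 pp.
transitivity (\sum_(1 <= k < n.+1 | (p %| k)%N) chi k * k%:R^-1 * (logn p k)%:R : R).
  rewrite [RHS]big_mkcond; apply: eq_bigr => k _; case: ifPn => // pk.
  by rewrite lognE (negbTE pk) !andbF mulr0.
rewrite sum_mul_dvd// /Lsum /Lsum_logn -big_split /= big_distrr /=.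
rewrite big_nat [RHS]big_nat; apply: eq_bigr => q /andP[q0 _].
rewrite lognM// (logn_prime _ pp) eqxx natrD chiM natrM invfM /= mulrDr mulr1 mulrDr.
by congr (_ + _); rewrite ?mulrA; ring.
Qed.

(** The bound is the fixed point of [t = (1 + t) / p], the inequality that the recursion
    propagates. *)
Lemma Lsum_logn_bound (R : realType) (p n : nat) : prime p ->
  `|Lsum_logn R p n| <= (p%:R - 1)^-1.
Proof.
move=> pp; have p1 : (1 : R) < p%:R by rewrite ltr1n prime_gt1.
elim/ltn_ind: n => -[|n] IH.
  by rewrite /Lsum_logn big_geq// normr0 invr_ge0 subr_ge0 ltW.
rewrite Lsum_logn_rec//; set m := (_ %/ _)%N.
have H : `|Lsum R m + Lsum_logn R p m| <= 1 + (p%:R - 1)^-1.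
  apply: (le_trans (ler_normD _ _)); apply: lerD.
    by have /andP[? ?] := Lsum_bounds R m; rewrite ger0_norm.
  by apply: IH; rewrite ltn_Pdiv// prime_gt1.
rewrite normrM; apply: (@le_trans _ _ (p%:R^-1 * (1 + (p%:R - 1)^-1))).
  apply: ler_pM => //; rewrite normrM normfV [`|p%:R|]ger0_norm ?ler0n//.
  rewrite ler_piMl ?invr_ge0 ?ler0n//; exact: normr_chi_le1.
rewrite le_eqVlt; apply/predU1P; left; field; lra.
Qed.

(** In the recursion, replacing [Lsum (n %/ p)] by [Lsum n] costs at most
    [(1 / p) * (p / n) = 1 / n]. *)
Lemma Lsum_logn_ge (R : realType) (p n : nat) : prime p -> (0 < n)%N ->
  chi p / p%:R * Lsum R n - n%:R^-1 - (p%:R * (p%:R - 1))^-1 <= Lsum_logn R p n.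
Proof.
move=> pp n0; have p1 : (1 : R) < p%:R by rewrite ltr1n prime_gt1.
have p0 := prime_gt0 pp; have p0' : (0 : R) < p%:R by rewrite ltr0n.
rewrite Lsum_logn_rec//; set m := (_ %/ _)%N.
have U := @Lsum_logn_bound R p m pp.
have D : `|Lsum R n - Lsum R m| <= p%:R / n%:R.
  apply: (le_trans (@Lsum_dist R m n (leq_div _ _))).
  rewrite -[leRHS]invrK invf_div lef_pV2 ?posrE ?ltr0n//; last by rewrite divr_gt0// ltr0n.
  by rewrite ler_pdivrMr// -natrM ler_nat ltnW// ltn_ceil.
have C : `|chi p / p%:R : R| <= p%:R^-1.
  rewrite normrM normfV [`|p%:R|]ger0_norm ?ler0n// [leRHS](_ : _ = 1 / p%:R); last by rewrite mul1r.
  rewrite ler_pM2r ?invr_gt0//; exact: normr_chi_le1.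
have H1 : `|chi p / p%:R * (Lsum R n - Lsum R m)| <= n%:R^-1.
  rewrite normrM; apply: (le_trans (ler_pM _ _ C D)) => //.
  by rewrite mulKf// gt_eqF.
have H2 : `|chi p / p%:R * Lsum_logn R p m| <= (p%:R * (p%:R - 1))^-1.
  by rewrite normrM invfM; apply: ler_pM.
move: H1 H2; rewrite mulrBr !ler_norml mulrDr; lra.
Qed.

Lemma ln_div_nonincr (R : realType) (k : nat) : (4 <= k)%N ->
  ln k.+1%:R / k.+1%:R <= ln k%:R / k%:R :> R.
Proof.
move=> k4; have k0 : (0 : R) < k%:R by rewrite ltr0n; lia.
rewrite -[k.+1%:R]natr1; set x := k%:R : R.
have x1 : 0 < x + 1 by rewrite addr_gt0.
rewrite ler_pdivrMr// mulrAC ler_pdivlMr//.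
(* The threshold 4 comes from [ln 4 = 2 ln 2 >= 1]. *)
have L : 1 <= ln x.
  apply: (@le_trans _ _ (ln 4%:R)); last exact: ler_ln_nat.
  have := ln_half_le R; rewrite (_ : 4%:R = 2 ^+ 2 :> R); last by rewrite -natrX.
  by rewrite lnXn//; lra.
have H := @ln_add1_sub_le R x k0.
have : x * (ln (x + 1) - ln x) <= x * x^-1 by rewrite ler_pM2l.
rewrite mulfV ?gt_eqF//; lra.
Qed.

(** The terms at 1 and 2 vanish, the term at 3 is nonpositive, and from 4 on [ln k / k] decreases,
    so the rest is at most [ln 4 / 4]. *)
Lemma chi_ln_sum_le (R : realType) (n : nat) :
  \sum_(1 <= k < n.+1) chi k * k%:R^-1 * ln k%:R <= 1 :> R.
Proof.
have c1 : chi 1 * 1%:R^-1 * ln 1%:R = 0 :> R by rewrite ln1 mulr0.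
have c2 : chi 2 * 2%:R^-1 * ln 2%:R = 0 :> R by rewrite /chi /= !mul0r.
have c3 : chi 3 * 3%:R^-1 * ln 3%:R <= 0 :> R.
  by rewrite /chi /= expr1 mulN1r mulNr oppr_le0 mulr_ge0// ln_nat_ge0.
have [n3|n3] := leqP n 2.
  case: n n3 => [|[|[|n]]] // _; first by rewrite big_geq.
    by rewrite big_nat1 c1.
  by rewrite big_ltn// big_nat1 c1 c2 addr0.
rewrite (@big_cat_nat _ _ _ 4)//= big_ltn// big_ltn// big_nat1 c1 c2.
have := @alternating_sum_bounds R (fun k => ln k%:R / k%:R) 4 n.+1.
move=> /(_ _ _)/andP[]; first by move=> k _; rewrite divr_ge0// ln_nat_ge0.
  by move=> k; exact: ln_div_nonincr.
rewrite /= expr2 mulN1r opprK mul1r => _.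
under [X in _ + X <= _]eq_bigr => k _ do rewrite mulrAC -mulrA.
have : ln 4%:R <= 4%:R :> R by rewrite ltW// ln_sublinear.
lra.
Qed.

(** Expanding [ln k] over primes in the sum of [chi k * ln k / k] gives [Lsum n * E <= 1 + 4 + 2],
    and [Lsum n >= 1 / 2] doubles the 7. *)
Lemma mertens_chi_le (R : realType) (n : nat) : (0 < n)%N ->
  \sum_(1 <= p < n.+1 | prime p) chi p * (ln p%:R / p%:R) <= 14 :> R.
Proof.
move=> n0; set E := \sum_(_ <= _ < _ | _) _.
have n0' : (0 : R) < n%:R by rewrite ltr0n.
have T : \sum_(1 <= k < n.+1) chi k * k%:R^-1 * ln k%:R =
    \sum_(1 <= p < n.+1 | prime p) ln p%:R * Lsum_logn R p n.
  rewrite /Lsum_logn; under [RHS]eq_bigr do rewrite big_distrr /=.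
  rewrite [RHS]exchange_big /= big_nat [RHS]big_nat; apply: eq_bigr => k /andP[k1 kn].
  rewrite (@ln_pfactor R k n)// big_distrr /=; apply: eq_bigr => p _.
  by rewrite [RHS]mulrC -[RHS]mulrA.
have G : Lsum R n * E - theta R n / n%:R
   - \sum_(1 <= p < n.+1 | prime p) ln p%:R / (p%:R * (p%:R - 1))
    <= \sum_(1 <= k < n.+1) chi k * k%:R^-1 * ln k%:R.
  rewrite T /theta /E big_distrr /= mulr_suml -!sumrB; apply: ler_sum => p pp.
  have := @Lsum_logn_ge R p n pp n0; have := @ln_nat_ge0 R p.
  set x := ln _ => x0 /(ler_wpM2l x0); apply: le_trans; rewrite le_eqVlt; apply/predU1P; left; ring.
have Th : theta R n / n%:R <= 4 by rewrite ler_pdivrMr// theta_le.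
have := sum_prime_ln_div_sqr_le R n; have := chi_ln_sum_le R n.
have := @Lsum_ge_half R n n0; nra.
Qed.

(** * The size of [omega n] and the contribution of primes up to [2 n] *)

Lemma nrootsE (R : realType) (p : nat) : (nroots p)%:R = 1 + chi p :> R.
Proof.
rewrite /nroots /chi; case: ifP => _; last by rewrite addr0.
by rewrite -signr_odd; case: ifP => _; rewrite ?expr0 ?expr1 ?subrr.
Qed.

Lemma sum_divn_pow_le (R : realType) (p n J : nat) : (1 < p)%N ->
  \sum_(1 <= j < J.+1) (n %/ p ^ j)%:R <= n%:R / (p%:R - 1) :> R.
Proof.
move=> p1; have p1' : (1 : R) < p%:R by rewrite ltr1n.
apply: (@le_trans _ _ (\sum_(1 <= j < J.+1) n%:R / p%:R ^+ j)).
  apply: ler_sum => j _; rewrite ler_pdivlMr ?exprn_gt0 ?(lt_trans ltr01)//.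
  by rewrite -natrX -natrM ler_nat leq_divM.
have -> : \sum_(1 <= j < J.+1) n%:R / p%:R ^+ j
    = n%:R * (1 - (p%:R ^+ J)^-1) / (p%:R - 1) :> R.
  elim: J => [|J IH]; first by rewrite big_geq// expr0 invr1 subrr mulr0 mul0r.
  rewrite big_nat_recr//= IH exprS; field.
  by rewrite expf_neq0 gt_eqF//=; lra.
rewrite ler_pM2r ?invr_gt0 ?subr_gt0// ler_piMr// gerBl invr_ge0 exprn_ge0//.
Qed.

Lemma sum_nat_le_minn (r n : nat) : (\sum_(1 <= k < n.+1) (k <= r) = minn n r)%N.
Proof.
elim: n => [|n IH]; first by rewrite big_geq// min0n.
by rewrite big_nat_recr//= IH; lia.
Qed.

(** An exponent of at least 4 forces [p ^ 4 <= 1 + n ^ 2], hence [p ^ 2 <= n]. Thus only about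
    [sqrt n] primes pay the full [ln (1 + n ^ 2)]; the others cost [3 ln p], summed by [theta]. *)
Lemma trunc_log_ln_le (R : realType) (p n : nat) : prime p -> (0 < n)%N ->
  (trunc_log p (1 + n ^ 2))%:R * ln p%:R <=
  3 * ln p%:R + (p ^ 2 <= n)%:R * ln (1 + n ^ 2)%:R :> R.
Proof.
move=> pp n0; have p1 := prime_gt1 pp; set J := trunc_log _ _.
have pJ : (p ^ J <= 1 + n ^ 2)%N by apply: trunc_logP.
have [J3|J4] := leqP J 3.
  apply: (@le_trans _ _ (3 * ln p%:R)); last by rewrite lerDl mulr_ge0// ln_nat_ge0.
  by rewrite ler_wpM2r ?ln_nat_ge0// (ler_nat _ J 3).
have -> : (p ^ 2 <= n)%N.
  have : (p ^ 4 <= 1 + n ^ 2)%N by apply: leq_trans pJ; rewrite leq_exp2l.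
  by rewrite (expnM p 2 2); nia.
apply: (@le_trans _ _ (ln (1 + n ^ 2)%:R)); last first.
  by rewrite mul1r lerDr mulr_ge0// ln_nat_ge0.
rewrite mulr_natl -lnXn ?ltr0n ?prime_gt0// -natrX; apply: ler_ln_nat => //.
by rewrite expn_gt0 prime_gt0.
Qed.

Lemma sum_small_sqr_ln_le (R : realType) (n N : nat) : (0 < n)%N ->
  \sum_(1 <= p < N.+1) (p ^ 2 <= n)%:R * ln (1 + n ^ 2)%:R <= 5 * n%:R :> R.
Proof.
move=> n0; have n1 : (1 : R) <= n%:R by rewrite ler1n.
set s := Num.sqrt (n%:R : R); pose r := Num.truncn s.
have s2 : s ^+ 2 = n%:R by rewrite sqr_sqrtr.
have s1 : 1 <= s by rewrite -sqrtr1 ler_wsqrtr.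
have rs : r%:R <= s by rewrite truncn_le sqrtr_ge0.
have cnt : \sum_(1 <= p < N.+1) (p ^ 2 <= n)%:R <= s :> R.
  apply: le_trans rs; rewrite -natr_sum ler_nat; apply: leq_trans (geq_minr N r).
  rewrite -sum_nat_le_minn; apply: leq_sum => p _.
  case: (boolP (p ^ 2 <= n)%N) => // pn.
  rewrite truncn_ge_nat ?sqrtr_ge0// -(@ler_pXn2r _ 2)//; rewrite ?nnegrE ?sqrtr_ge0//.
  by rewrite s2 -natrX ler_nat pn.
rewrite -mulr_suml.
have L : ln (1 + n ^ 2)%:R <= 1 + 4 * s :> R.
  apply: (@le_trans _ _ (ln (2 * n ^ 2)%:R)); first by apply: ler_ln_nat => //; nia.
  have s0 : 0 < s := lt_le_trans ltr01 s1.
  rewrite natrM natrX -s2 -exprM lnM ?posrE ?exprn_gt0// lnXn//.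
  have := @ln_sublinear R s (lt_le_trans ltr01 s1); have := ln2_le1 R.
  rewrite -[ln s *+ _]mulr_natl; lra.
apply: (@le_trans _ _ (s * (1 + 4 * s))).
  apply: (ler_pM _ _ cnt L); [exact: sumr_ge0|exact: ln_nat_ge0].
by rewrite -s2; nra.
Qed.

Lemma sum_logn_omega_le (R : realType) (n : nat) : (0 < n)%N ->
  \sum_(1 <= p < (2 * n).+1 | prime p) (logn p (omega n))%:R * ln p%:R
  <= n%:R * ln n%:R + 81 * n%:R :> R.
Proof.
move=> n0; have n0' : (0 : R) < n%:R by rewrite ltr0n.
set w : R := ln (1 + n ^ 2)%:R.
pose F (p : nat) : R := n%:R * (ln p%:R / p%:R) + n%:R * (chi p * (ln p%:R / p%:R))
  + 2 * n%:R * (ln p%:R / (p%:R * (p%:R - 1))) + 6 * ln p%:R + 2 * ((p ^ 2 <= n)%:R * w).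
have step p : prime p -> (logn p (omega n))%:R * ln p%:R <= F p.
  move=> pp; have p1 := prime_gt1 pp; have p1' : (1 : R) < p%:R by rewrite ltr1n.
  have x0 := ln_nat_ge0 R p; set x : R := ln p%:R in x0 *.
  have c1 : -1 <= (chi p : R) <= 1 by rewrite -ler_norml normr_chi_le1.
  have : (logn p (omega n))%:R <= (1 + chi p) *
     (n%:R / (p%:R - 1) + (trunc_log p (1 + n ^ 2))%:R) :> R.
    have := @logn_omega_le p n pp; rewrite -(ler_nat R) natrM nrootsE natr_sum.
    move=> /le_trans; apply; apply: ler_wpM2l; first by lra.
    under eq_bigr do rewrite natrD.
    rewrite big_split /= big_const_nat subn1 /= iter_addr addr0 lerD2r.
    exact: sum_divn_pow_le.
  move=> /(ler_wpM2r x0) /le_trans; apply.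
  have := @trunc_log_ln_le R p n pp n0; rewrite -/x -/w.
  set J : R := _%:R; set e : R := _ * w => HJ.
  have e0 : 0 <= e by rewrite mulr_ge0// ln_nat_ge0.
  have y0 : 0 <= x / (p%:R * (p%:R - 1)) by rewrite divr_ge0// mulr_ge0//; lra.
  rewrite /F -/x -/e.
  (* Writing [1 / (p - 1)] as [1 / p + 1 / (p (p - 1))] isolates the two Mertens sums from a
     convergent one. *)
  have -> : (1 + chi p) * (n%:R / (p%:R - 1) + J) * x =
    n%:R * (x / p%:R) + n%:R * (chi p * (x / p%:R)) +
    (1 + chi p) * n%:R * (x / (p%:R * (p%:R - 1))) + (1 + chi p) * (J * x).
    by field; rewrite !gt_eqF//; lra.
  have H1 : (1 + chi p) * n%:R * (x / (p%:R * (p%:R - 1))) <=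
     2 * n%:R * (x / (p%:R * (p%:R - 1))).
    by rewrite ler_wpM2r// ler_wpM2r//; lra.
  have H2 : (1 + chi p) * (J * x) <= 2 * (3 * x + e).
    apply: (@le_trans _ _ ((1 + chi p) * (3 * x + e))).
      by rewrite ler_wpM2l//; lra.
    by rewrite ler_wpM2r//; lra.
  lra.
apply: (@le_trans _ _ (\sum_(1 <= p < (2 * n).+1 | prime p) F p)).
  by apply: ler_sum => p /step.
rewrite /F !big_split /= -!big_distrr /=.
have n2 : (0 < 2 * n)%N by lia.
(* The constant is [81 = 5 + 14 + 4 + 48 + 10], one summand for each term of [F]; the 5 is
   [4 + ln 2] rounded up, and 48 is [6 * 4 * 2] from [theta]. *)
have M := @mertens_le R _ n2; have E := @mertens_chi_le R _ n2.
have Q := sum_prime_ln_div_sqr_le R (2 * n); have T := theta_le R (2 * n).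
have W : \sum_(1 <= p < (2 * n).+1 | prime p) (p ^ 2 <= n)%:R * w <= 5 * n%:R.
  apply: le_trans (@sum_small_sqr_ln_le R n (2 * n) n0); rewrite big_mkcond.
  by apply: ler_sum => p _; case: ifP => // _; rewrite mulr_ge0// ln_nat_ge0.
move: M T; rewrite natrM lnM ?posrE// -/(theta R (2 * n)) => M T.
have := ler_wpM2l (ltW n0') (ln2_le1 R); have := ler_wpM2l (ltW n0') M.
have := ler_wpM2l (ltW n0') E; have := ler_wpM2l (ltW n0') Q.
move: T W; rewrite /theta.
lra.
Qed.

(** Stirling's lower bound for [2 ln n!], since [1 + k ^ 2 >= k ^ 2]. *)
Lemma ln_omega_ge (R : realType) (n : nat) : (0 < n)%N ->
  2 * (n%:R * ln n%:R) - 2 * n%:R <= ln (omega n)%:R :> R.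
Proof.
elim: n => // -[_ _|n IH _]; first by rewrite ln1 (le_trans _ (ln_nat_ge0 R _))//; lra.
rewrite omegaS natrM lnM ?posrE ?ltr0n ?omega_gt0//.
have := IH isT.
have : 2 * ln n.+2%:R <= ln (1 + n.+2 ^ 2)%:R :> R.
  by rewrite mulr_natl -lnXn// -natrX; apply: ler_ln_nat; rewrite ?expn_gt0//; lia.
have : (0 : R) < n.+1%:R by [].
rewrite -[n.+2%:R]natr1; set x : R := n.+1%:R => x0.
have H := @ln_add1_sub_le R x x0.
have : x * (ln (x + 1) - ln x) <= x * x^-1 by rewrite ler_pM2l.
by rewrite mulfV ?gt_eqF//; lra.
Qed.

(** * Gaussian integers and the tangent of the sum *)

Lemma Posz_absz_sqr (x : int) : (`|x| ^ 2)%N%:Z = x ^+ 2.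
Proof. by rewrite -mulnn PoszM abszE -expr2 real_normK ?num_real. Qed.

(* Here [A + i B = \prod_k (1 + i k)], in polar form. *)
Lemma polar_sum_atan (R : realType) (n : nat) : exists (A B : int) (r : R),
  [/\ 0 < r, A ^+ 2 + B ^+ 2 = (omega n)%:Z,
   A%:~R = r * cos (\sum_(1 <= k < n.+1) atan k%:R) &
   B%:~R = r * sin (\sum_(1 <= k < n.+1) atan k%:R)].
Proof.
elim: n => [|n [A [B [r [r0 AB HA HB]]]]].
  exists 1, 0, 1; rewrite big_geq// cos0 sin0 /omega big_geq//; split => //.
  - by rewrite mulr1.
  - by rewrite mulr0.
rewrite big_nat_recr//=; set t := \sum_(_ <= _ < _) _ in HA HB *.
set k := n.+1; have c0 : 0 < cos (atan (k%:R : R)).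
  by rewrite cos_atan invr_gt0 sqrtr_gt0 ltr_pwDl// sqr_ge0.
have sE : sin (atan (k%:R : R)) = k%:R * cos (atan k%:R).
  by rewrite -{2}[k%:R](@atanK R) /tan divfK// gt_eqF.
(* Multiplication by [1 + i k], whose modulus is [1 / cos (atan k)]. *)
exists (A - k%:Z * B), (B + k%:Z * A), (r / cos (atan k%:R)); split.
- by rewrite divr_gt0.
- rewrite omegaS PoszM -AB PoszD -/k; have -> : Posz (k ^ 2) = k%:Z ^+ 2 by rewrite -mulnn PoszM -expr2.
  ring.
- rewrite cosD sE rmorphB rmorphM /= HA HB -pmulrn; field.
  by rewrite gt_eqF.
- rewrite sinD sE rmorphD rmorphM /= HA HB -pmulrn; field.
  by rewrite gt_eqF.
Qed.

Lemma omega_of_xseq_int (R : realType) (n : nat) (m : int) :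
  xseq R n = m%:~R -> exists a : nat, omega n = (a ^ 2 * (1 + `|m| ^ 2))%N.
Proof.
have [A [B [r [r0 AB HA HB]]]] := polar_sum_atan R n.
rewrite /xseq /tan; set t := \sum_(_ <= _ < _) _ in HA HB *.
have [c0|c0] := eqVneq (cos t) 0.
  (* A vanishing cosine gives [tan t = 0] by the convention on inverses, hence [m = 0]; then [A = 0]
     and [omega n = B ^ 2] still has the required form. *)
  rewrite c0 invr0 mulr0 => /esym/eqP; rewrite intr_eq0 => /eqP ->.
  exists `|B|%N; apply/eqP; rewrite -eqz_nat -AB.
  move: HA; rewrite c0 mulr0 => /eqP; rewrite intr_eq0 => /eqP ->.
  by rewrite expr0n add0r absz0 exp0n// addn0 muln1 Posz_absz_sqr.
move=> sm; exists `|A|%N; apply/eqP; rewrite -eqz_nat -AB.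
have -> : B = m * A.
  apply/eqP; rewrite -(eqr_int R) rmorphM /= HA HB -sm.
  by rewrite mulrCA divfK.
by rewrite PoszM PoszD !Posz_absz_sqr; apply/eqP; ring.
Qed.

(** * Growth of [|m|] *)

Lemma cvg_div_ln (R : realType) (c : R) : (fun n => c / ln n%:R) @ \oo --> (0 : R).
Proof.
rewrite -[0](mulr0 c); apply: cvgMr.
apply/gtr0_cvgV0.
  near=> n; apply: ln_gt0; rewrite ltr1n; near: n; exact: nbhs_infty_gt.
apply/cvgryPge => x; near=> n.
rewrite -ler_expR lnK; last by rewrite posrE ltr0n; near: n; exact: nbhs_infty_gt.
near: n; exact: nbhs_infty_ger.
Unshelve. all: by end_near. Qed.

(** Subtracting the small primes' [n ln n + 81 n] from [2 n ln n - 2 n] leaves this bound for the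
    cofactor of the square. *)
Lemma ln_square_part_ge (R : realType) (n a b : nat) :
  (0 < n)%N -> omega n = (a ^ 2 * b)%N ->
  n%:R * ln n%:R - 83 * n%:R <= ln b%:R :> R.
Proof.
move=> n0 E; have /andP[_ b0] : (0 < a ^ 2)%N && (0 < b)%N.
  by rewrite -muln_gt0 -E omega_gt0.
have := @omega_le_small_part n a b E; set P := (\prod_(_ <= _ < _ | _) _)%N.
have P0 : (0 < P)%N.
  by apply: prodn_cond_gt0 => p pp; rewrite expn_gt0 prime_gt0.
move=> /(@ler_ln_nat R _ _ (omega_gt0 n)); rewrite natrM lnM ?posrE ?ltr0n//.
have -> : ln P%:R = \sum_(1 <= p < (2 * n).+1 | prime p) (logn p (omega n))%:R * ln p%:R :> R.
  rewrite /P natr_prod ln_prod; last by move=> p pp; rewrite ltr0n expn_gt0 prime_gt0.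
  by apply: eq_bigr => p pp; rewrite natrX lnXn ?ltr0n ?prime_gt0// mulr_natl.
have := @sum_logn_omega_le R n n0; have := @ln_omega_ge R n n0; lra.
Qed.

Theorem theorem1p1 (R : realType) :
  exists eps : nat -> R,
    eps @ \oo --> (0 : R) /\
    forall (n : nat) (m : int),
      (1 <= n)%N ->
      xseq R n = m%:~R ->
      ((Kseq n)%:Z %| 1 + m ^+ 2)%Z /\
      ((1 < Kseq n)%N ->
        Num.sqrt ((Kseq n)%:R - 1) <= `|m%:~R : R| /\
        (1 / 2 + eps n) * (n%:R * ln n%:R) <= ln `|m%:~R : R|).
Proof.
(* Halving [n ln n - 83 n <= 1 + 2 ln |m|] loses [(83 n + 1) / 2], at most [42 n]. *)
exists (fun n => - 42 / ln n%:R); split; first exact: cvg_div_ln.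
move=> n m n0 /omega_of_xseq_int[a E].
have Kd := @Kseq_dvd n a _ E.
have mE : 1 + m ^+ 2 = (1 + `|m| ^ 2)%N%:Z :> int.
  by rewrite PoszD Posz_absz_sqr.
split; first by rewrite mE.
move=> K1; have Kle : (Kseq n <= 1 + `|m| ^ 2)%N by apply: dvdn_leq.
rewrite -intr_norm -abszE -pmulrn; split.
  apply: (@le_trans _ _ (Num.sqrt (`|m|%:R ^+ 2))); last by rewrite sqrtr_sqr ger0_norm.
  by rewrite ler_wsqrtr// lerBlDl -natrX (_ : 1 = 1%:R)// -natrD ler_nat.
(* [m = 0] would give [Kseq n <= 1]. *)
have m0 : (0 < `|m|)%N by case: `|m|%N Kle K1 => //; lia.
have L := @ln_square_part_ge R n a _ n0 E.
have U : ln (1 + `|m| ^ 2)%:R <= 1 + 2 * ln `|m|%:R :> R.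
  apply: (@le_trans _ _ (ln (2 * `|m| ^ 2)%:R)); first by apply: ler_ln_nat => //; nia.
  rewrite natrM natrX lnM ?posrE ?exprn_gt0 ?ltr0n// lnXn ?ltr0n//.
  by have := ln2_le1 R; rewrite -[ln `|m|%:R *+ _]mulr_natl; lra.
have n1 : (1 : R) <= n%:R by rewrite ler1n.
(* At [n = 1] the factor [ln 1 = 0] reduces the claim to [0 <= ln |m|]; beyond it, [ln n] is nonzero
   and may be cancelled. *)
have [n1'|n2] := leqP n 1.
  have -> : n = 1%N by lia.
  by rewrite ln1 !mulr0; apply: ln_nat_ge0.
have l0 : 0 < ln n%:R :> R by apply: ln_gt0; rewrite ltr1n.
have -> : (1 / 2 + - 42 / ln n%:R) * (n%:R * ln n%:R) = n%:R * ln n%:R / 2 - 42 * n%:R :> R.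
  by field; rewrite gt_eqF.
lra.
Qed.
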